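(* Let $(B,+,\circ)$ be a skew brace. Suppose $B$ satisfies the following properties: - for every $b\in B$, either $\langle b\rangle_\circ$ or $\langle b\rangle_+$ is an ideal of $B$; - $(B,+)$ has a non-periodic element $x$ (an element of infinite order). Then $B$ is a trivial brace.
   Context: A skew brace is a triple $(B,+,\circ)$ with $(B,+)$, $(B,\circ)$ (not necessarily abelian) groups such that $a\circ(b+c)=a\circ b-a+a\circ c$ for all $a,b,c\in B$. For $a\in B$ put $\lambda_a(b)=-a+a\circ b$; then $\lambda:a\mapsto\lambda_a$ is a homomorphism $(B,\circ)\to\operatorname{Aut}(B,+)$. An ideal is a subgroup of $(B,+)$ that is normal in $(B,+)$, invariant under all $\lambda_b$, and normal in $(B,\circ)$. $B$ is trivial (a trivial brace) if $a+b=a\circ b$ for all $a,b\in B$. $\langle b\rangle_+$ and $\langle b\rangle_\circ$ denote the subgroups generated by $b$ in $(B,+)$ and $(B,\circ)$ respectively. *)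

(* Defs.v *)
From HB Require Import structures.
From mathcomp Require Import all_boot.
From mathcomp Require Import classical_sets.

Set Implicit Arguments.
Unset Strict Implicit.
Unset Printing Implicit Defensive.

Local Open Scope classical_set_scope.

(* The multiplicative groupType structure is (B, o).  The group (B, +) need not
   be abelian, which rules out zmodType, so its operations and laws are given
   here.  That 0 = 1 is a consequence. *)
HB.mixin Record isSkewBrace B of Group B := {
  sb_add : B -> B -> B;
  sb_zero : B;
  sb_opp : B -> B;
  sb_addA : associative sb_add;
  sb_add0b : left_id sb_zero sb_add;
  sb_addb0 : right_id sb_zero sb_add;
  sb_addNb : left_inverse sb_zero sb_opp sb_add;
  sb_addbN : right_inverse sb_zero sb_opp sb_add;
  sb_circD : forall a b c : B,
    (a * sb_add b c)%g = sb_add (sb_add (a * b)%g (sb_opp a)) (a * c)%g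
}.

#[short(type="skewBraceType")]
HB.structure Definition SkewBrace := {B of isSkewBrace B & Group B}.

Declare Scope skew_brace_scope.
Delimit Scope skew_brace_scope with SB.
Notation "0" := (@sb_zero _) : skew_brace_scope.
Notation "a + b" := (sb_add a b) : skew_brace_scope.
Notation "- a" := (sb_opp a) : skew_brace_scope.
Notation "a - b" := (sb_add a (sb_opp b)) : skew_brace_scope.
Notation "a ∘ b" := (a * b)%g
  (at level 40, left associativity) : skew_brace_scope.
Local Open Scope skew_brace_scope.

Section SkewBraceTheory.
Variable B : skewBraceType.
Implicit Types (a b x y : B) (I : set B).

Definition sb_muln x (n : nat) : B := iter n (sb_add x) 0.

Definition sb_lambda a b : B := - a + a ∘ b.

Definition add_subgroup I : Prop :=
  [/\ I 0, forall x y, I x -> I y -> I (x + y) & forall x, I x -> I (- x)].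

Definition circ_subgroup I : Prop :=
  [/\ I 1%g, forall x y, I x -> I y -> I (x ∘ y) & forall x, I x -> I (x^-1)%g].

Definition add_normal I : Prop :=
  add_subgroup I /\ forall a x, I x -> I (a + x - a).

Definition circ_normal I : Prop :=
  circ_subgroup I /\ forall a x, I x -> I (a ∘ x ∘ a^-1%g).

Definition sb_ideal I : Prop :=
  [/\ add_normal I, forall b, sb_lambda b @` I `<=` I & circ_normal I].

Definition add_cycle b : set B := smallest add_subgroup [set b].

Definition circ_cycle b : set B := smallest circ_subgroup [set b].

Definition add_infinite_order x : Prop :=
  forall n : nat, (0 < n)%N -> sb_muln x n <> 0.

End SkewBraceTheory.

Definition trivial_brace (B : skewBraceType) : Prop :=
  forall a b : B, a + b = a ∘ b.

(* Main.v *)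
Require Import Defs.
From HB Require Import structures.
From mathcomp Require Import all_boot all_algebra zify.
From mathcomp Require Import boolp classical_sets.

(** The triviality of B says that every lambda_a is the identity, since
a o b = a + lambda_a(b).

Two ideals I and J with I ∩ J = 0 act trivially on each other: for a in I and
b in J, the element - b + lambda_a(b) lies in both, and so does the additive
commutator of a and b.  So everything rests on having enough ideals, and the
hypothesis supplies them as soon as the brace structure on the cyclic
subgroup generated by an element of infinite order is understood.

The key point is that an element x of infinite additive order satisfies
lambda_x(x) = x, hence nx = x^n for all n, so that both cyclic subgroups of x
are one and the same ideal, isomorphic to the trivial brace Z.
- If <x>_+ is an ideal, then lambda_x(x) = x or - x.  In the second case <x>_+
  is Z with m o n = m + (-1)^m n, and neither cyclic subgroup of the element 3
  of that brace is an ideal ([add_cycle_ideal_lambda_self]).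
- If <x>_o is an ideal, then so are all the <x^n>_o, n != 0, and lambda_x
  induces on the cosets of <x^p>_o, p prime, a permutation with p-th power 1
  that fixes the coset 0.  The remaining p - 1 cosets leave no room for a cycle
  of length p, so lambda_x(x) is congruent to x modulo <x^p>_o for every prime
  p, and they are equal ([circ_cycle_ideal_lambda_self]).

Next, every lambda_a fixes every b of infinite additive order
([infinite_lambda_fixed]).  A torsion element a lies in an ideal that meets
<b> trivially.  If a has infinite order, then <a> and <b> are ideals; when they
meet nontrivially, some nonzero multiple nb is in <a>, so is fixed by lambda_a,
which forces lambda_a(b) = b as lambda_a(b) is a multiple of b.

Finally let b be torsion and let x have infinite order.  The ideals of b and x
are disjoint, so b and x commute additively and b + x has infinite order.  Then
lambda_a fixes x and b + x, hence b. *)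

Set Implicit Arguments.
Unset Strict Implicit.
Unset Printing Implicit Defensive.

Import GRing.Theory.

(** * Integer powers in a group *)

Lemma pigeonhole (n : nat) (P : nat -> nat -> Prop) :
    (forall k, exists2 i, (i < n)%N & P k i) ->
  exists k l i, [/\ (k < l <= n)%N, P k i & P l i].
Proof.
move=> hP.
have /choice[h hh] (k : 'I_n.+1) : exists i : 'I_n, P k i.
  by have [i lt_in Pki] := hP k; exists (Ordinal lt_in).
have [|/injectivePn[k [l neq_kl eq_h]]] := boolP (injectiveb h).
  by move=> /injectiveP/leq_card; rewrite !card_ord ltnn.
wlog lt_kl : k l neq_kl eq_h / (k < l)%N.
  move=> W; case: (ltngtP k l) => [||eq_kl]; first exact: W.
    by apply: W; rewrite // eq_sym.
  by rewrite (ord_inj eq_kl) eqxx in neq_kl.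
exists k, l, (h k); split=> //; last by rewrite eq_h.
by rewrite lt_kl -ltnS ltn_ord.
Qed.

Section IntegerPowers.
Local Open Scope group_scope.
Variable G : groupType.
Implicit Types (x y : G) (m n : int).

Definition expgz x n : G :=
  match n with Posz k => x ^+ k | Negz k => x ^- k.+1 end.

Definition aperiodic x : Prop := forall n : nat, (0 < n)%N -> x ^+ n <> 1.

Lemma expgz1 x : expgz x 1%R = x.
Proof. by []. Qed.

Lemma expgzS x n : expgz x (n + 1)%R = x * expgz x n.
Proof.
case: n => [n|[|n]]; first by rewrite -[1%R]/(Posz 1) -PoszD addn1 /= expgS.
  by rewrite /= mulgV.
rewrite (_ : (Negz n.+1 + 1)%R = Negz n) ?NegzE; last by lia.
by rewrite -NegzE /= [x ^+ n.+2]expgSr invgM mulVKg.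
Qed.

(** Integer powers are determined by the recursion in the exponent; the
exponent laws, the compatibility with morphisms and the comparison of the two
group laws of a brace are all obtained from this. *)
Lemma expgz_unique x (f : int -> G) :
  f 0%R = 1 -> (forall n, f (n + 1)%R = x * f n) -> forall n, f n = expgz x n.
Proof.
move=> f0 fS; elim/int_rect => [//|n IHn|n IHn].
  by rewrite -addn1 PoszD fS IHn expgzS.
have eq_n : (- n.+1%:Z + 1)%R = (- n%:Z)%R by lia.
by apply: (mulgI x); rewrite -fS -expgzS eq_n.
Qed.

Lemma expgzD x m n : expgz x (m + n)%R = expgz x m * expgz x n.
Proof.
have eq_mn : (expgz x (m + n)%R / expgz x n) = expgz x m.
  apply: (@expgz_unique x (fun m => expgz x (m + n)%R / expgz x n)).
    by rewrite add0r mulgV.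
  by move=> k; rewrite addrAC expgzS mulgA.
by rewrite -eq_mn mulgVK.
Qed.

Lemma expgzN x n : expgz x (- n)%R = (expgz x n)^-1.
Proof. by apply: esym; apply: mulg1_eq; rewrite -expgzD subrr. Qed.

Lemma expgz1n n : expgz 1 n = 1.
Proof. by case: n => n /=; rewrite expg1n ?invg1. Qed.

Lemma expgzM x m n : expgz x (m * n)%R = expgz (expgz x m) n.
Proof.
apply: (@expgz_unique _ (fun n => expgz x (m * n)%R)); first by rewrite mulr0.
by move=> k; rewrite mulrDr mulr1 addrC expgzD.
Qed.

Lemma expgz_aperiodic_eq1 x n : aperiodic x -> expgz x n = 1 -> n = 0%R.
Proof.
move=> apx; case: n => [[|n]|n] //= xn1; first by case: (apx n.+1).
by case: (apx n.+1) => //; apply: invg_inj; rewrite xn1 invg1.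
Qed.

Lemma expgz_inj x : aperiodic x -> injective (expgz x).
Proof.
move=> apx m n eq_x; apply/eqP; rewrite -subr_eq0; apply/eqP.
by apply: (expgz_aperiodic_eq1 apx); rewrite expgzD expgzN eq_x mulgV.
Qed.

Lemma expgz_periodic x (k : nat) n : (0 < k)%N -> x ^+ k = 1 ->
  exists2 i, (i < k)%N & expgz x n = x ^+ i.
Proof.
move=> k_gt0 xk1; exists `|(n %% k)%Z|%N; first by lia.
have -> : x ^+ `|(n %% k)%Z|%N = expgz x (n %% k)%Z.
  by rewrite -[in RHS](@gez0_abs (n %% k)%Z) //; lia.
rewrite {1}(divz_eq n k) mulrC expgzD expgzM /= xk1.
by case: (n %/ k)%Z => l /=; rewrite expg1n ?invg1 mul1g.
Qed.

Lemma expgz_closed (P : G -> Prop) x n :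
    P 1 -> (forall y z, P y -> P z -> P (y * z)) ->
    (forall y, P y -> P y^-1) -> P x ->
  P (expgz x n).
Proof.
move=> P1 PM PV Px.
have PX k : P (x ^+ k) by elim: k => [|k IHk] //; rewrite expgS; apply: PM.
by case: n => k //=; apply: PV.
Qed.

(** In a brace both group laws live on the same set, so this is how finiteness
of a cyclic subgroup for one law bounds the order of an element for the other.
*)
Lemma aperiodic_powers_infinite x (g : nat -> G) (k : nat) :
  aperiodic x -> ~ forall n : nat, exists2 i, (i < k)%N & x ^+ n = g i.
Proof.
move=> apx /pigeonhole[m [n [i [/andP[lt_mn _] <- eq_x]]]].
have [eq_mn] := @expgz_inj _ apx n m eq_x.
by rewrite eq_mn ltnn in lt_mn.
Qed.

End IntegerPowers.

Lemma expgz_morph (G H : groupType) (f : G -> H) :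
    (forall x y, f (x * y) = f x * f y)%g ->
  forall x n, f (expgz x n) = expgz (f x) n.
Proof.
move=> fM x; apply: expgz_unique => [|n]; last by rewrite expgzS fM.
by apply: (mulgI (f 1%g)); rewrite -fM !mulg1.
Qed.

(** * The additive group and the maps lambda *)

(** A copy of the carrier on which the multiplicative notation and theory of
groups refer to the addition of the brace. *)
Definition add_group (B : skewBraceType) : Type := B.

HB.instance Definition _ (B : skewBraceType) := Choice.on (add_group B).

HB.instance Definition _ (B : skewBraceType) :=
  isGroup.Build (add_group B) (@sb_addA B) (@sb_add0b B) (@sb_addb0 B)
    (@sb_addNb B) (@sb_addbN B).

Section SkewBrace.
Local Open Scope skew_brace_scope.
Local Open Scope classical_set_scope.
Variable B : skewBraceType.
Implicit Types (a b c x y z : B) (m n : int) (I J : set B).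

Definition zmul x n : B := expgz (x : add_group B) n.

Lemma addVKb a b : a + (- a + b) = b.
Proof. exact: (@mulVKg (add_group B)). Qed.

Lemma addbI a b c : a + b = a + c -> b = c.
Proof. exact: (@mulgI (add_group B)). Qed.

Lemma addIb a b c : b + a = c + a -> b = c.
Proof. exact: (@mulIg (add_group B)). Qed.

Lemma oppD a b : - (a + b) = - b - a.
Proof. exact: (@invgM (add_group B)). Qed.

Lemma oppK a : - - a = a.
Proof. exact: (@invgK (add_group B)). Qed.

Lemma one_eq0 : 1%g = 0 :> B.
Proof.
have := sb_circD (1%g : B) 0 0; rewrite !mul1g !sb_addb0 sb_add0b => e.
by rewrite -(oppK 1%g) -e; apply: (@invg1 (add_group B)).
Qed.

Lemma circE a b : a ∘ b = a + sb_lambda a b.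
Proof. by rewrite /sb_lambda addVKb. Qed.

Lemma lambda1 b : sb_lambda 1%g b = b.
Proof.
by rewrite /sb_lambda mul1g one_eq0 -[- 0]sb_addb0 sb_addNb sb_add0b.
Qed.

Lemma lambdaD a b c : sb_lambda a (b + c) = sb_lambda a b + sb_lambda a c.
Proof. by rewrite /sb_lambda sb_circD !sb_addA. Qed.

Lemma lambda_zmul a b n : sb_lambda a (zmul b n) = zmul (sb_lambda a b) n.
Proof. exact: (@expgz_morph (add_group B) (add_group B) _ (lambdaD a)). Qed.

Lemma lambdaN a b : sb_lambda a (- b) = - sb_lambda a b.
Proof. exact: (lambda_zmul a b (- 1)%R). Qed.

(** The map a |-> lambda_a is a morphism on (B, o): expand
lambda_a (- b + b o c) by additivity of lambda_a; the terms in a cancel. *)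
Lemma lambdaM a b c : sb_lambda (a ∘ b) c = sb_lambda a (sb_lambda b c).
Proof.
rewrite {3}/sb_lambda lambdaD lambdaN {2 3}/sb_lambda oppD oppK -sb_addA addVKb.
by rewrite mulgA.
Qed.

Lemma lambdaVK a b : sb_lambda a (sb_lambda a^-1%g b) = b.
Proof. by rewrite -lambdaM mulgV lambda1. Qed.

Lemma lambdaKV a b : sb_lambda a^-1%g (sb_lambda a b) = b.
Proof. by rewrite -lambdaM mulVg lambda1. Qed.

Lemma zmulD x m n : zmul x (m + n)%R = zmul x m + zmul x n.
Proof. exact: (@expgzD (add_group B)). Qed.

Lemma zmulM x m n : zmul x (m * n)%R = zmul (zmul x m) n.
Proof. exact: (@expgzM (add_group B)). Qed.

Lemma sb_mulnE x (k : nat) : sb_muln x k = zmul x k.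
Proof. exact: (@iter_mulg_1 (add_group B)). Qed.

Lemma add_infinite_aperiodic x :
  add_infinite_order x -> aperiodic (x : add_group B).
Proof. by move=> infx k /infx; rewrite sb_mulnE. Qed.

Lemma zmul_inj x : add_infinite_order x -> injective (zmul x).
Proof. by move/add_infinite_aperiodic/expgz_inj. Qed.

(** * Cyclic subgroups and ideals *)

Lemma add_cycleP b y : add_cycle b y <-> exists n, y = zmul b n.
Proof.
split=> [|[n ->] S [[S0 SD SN] Sb]].
  apply: (@smallest_sub _ _ _ [set y | exists n, y = zmul b n]).
    split=> [|_ _ [m ->] [n ->]|_ [n ->]]; first by exists 0%R.
      by exists (m + n)%R; rewrite zmulD.
    by exists (- n)%R; rewrite /zmul expgzN.
  by move=> _ ->; exists 1%R.
by apply: (@expgz_closed (add_group B) S); last exact: Sb.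
Qed.

Lemma circ_cycleP b y : circ_cycle b y <-> exists n, y = expgz b n.
Proof.
split=> [|[n ->] S [[S1 SM SV] Sb]].
  apply: (@smallest_sub _ _ _ [set y | exists n, y = expgz b n]).
    split=> [|_ _ [m ->] [n ->]|_ [n ->]]; first by exists 0%R.
      by exists (m + n)%R; rewrite expgzD.
    by exists (- n)%R; rewrite expgzN.
  by move=> _ ->; exists 1%R.
by apply: expgz_closed => //; exact: Sb.
Qed.

Lemma add_cycle_zmul b n : add_cycle b (zmul b n).
Proof. by apply/add_cycleP; exists n. Qed.

Lemma circ_cycle_expgz b n : circ_cycle b (expgz b n).
Proof. by apply/circ_cycleP; exists n. Qed.

Lemma add_cycle_id b : add_cycle b b.
Proof. exact: sub_gen_smallest. Qed.

Lemma circ_cycle_id b : circ_cycle b b.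
Proof. exact: sub_gen_smallest. Qed.

Lemma ideal_lambda I a b : sb_ideal I -> I b -> I (sb_lambda a b).
Proof. by move=> [_ + _] Ib; apply; exists b. Qed.

(** Write a o b = b o i with i in I by normality in (B, o); then
a o b = b + lambda_b(i), so lambda_a(b) = - a + b + lambda_b(i), which differs
from b by elements of I by normality in (B, +). *)
Lemma ideal_lambdaB I a b : sb_ideal I -> I a -> I (- b + sb_lambda a b).
Proof.
move=> idI Ia; have [[[I0 ID IN] conjI] lamI [[_ IM IV] cconjI]] := idI.
have [l Il ->] : exists2 l, I l & sb_lambda a b = - a + (b + l).
  exists (sb_lambda b (b^-1%g ∘ a ∘ b)).
    by apply: ideal_lambda => //; rewrite -{2}(invgK b); apply: cconjI.
  by rewrite -circE !mulgA mulgV mul1g.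
rewrite !sb_addA; apply: ID => //.
by rewrite -[X in _ + X]oppK; apply: conjI; apply: IN.
Qed.

Lemma disjoint_ideals_lambda I J a b : sb_ideal I -> sb_ideal J ->
  (forall y, I y -> J y -> y = 0) -> I a -> J b -> sb_lambda a b = b.
Proof.
move=> idI idJ IJ0 Ia Jb; apply: (@addbI (- b)); rewrite sb_addNb.
have [[[_ JD JN] _] _ _] := idJ.
apply: IJ0; first exact: ideal_lambdaB.
by apply: JD; [exact: JN | exact: ideal_lambda].
Qed.

Lemma disjoint_ideals_addC I J a b : sb_ideal I -> sb_ideal J ->
  (forall y, I y -> J y -> y = 0) -> I a -> J b -> a + b = b + a.
Proof.
move=> [[[_ ID IN] conjI] _ _] [[[_ JD JN] conjJ] _ _] IJ0 Ia Jb.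
apply: (@addIb (- (b + a))); rewrite sb_addbN oppD; apply: IJ0.
  rewrite -sb_addA; apply: ID => //; rewrite sb_addA.
  by apply: conjI; apply: IN.
by rewrite sb_addA; apply: JD; [exact: conjJ | exact: JN].
Qed.

(** If lambda_x fixes x, it fixes every nx, so that x o nx = (n + 1) x. *)
Lemma lambda_self_expgz x n : sb_lambda x x = x -> expgz x n = zmul x n.
Proof.
move=> fixx; apply: esym; apply: expgz_unique => [|m].
  exact: esym one_eq0.
by rewrite circE lambda_zmul fixx addrC zmulD.
Qed.

Lemma lambda_self_cycles x :
  sb_lambda x x = x -> circ_cycle x = add_cycle x.
Proof.
move=> fixx; apply/seteqP; split=> y.
  move=> /circ_cycleP[n ->]; rewrite lambda_self_expgz //.
  exact: add_cycle_zmul.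
move=> /add_cycleP[n ->]; rewrite -lambda_self_expgz //.
exact: circ_cycle_expgz.
Qed.

(** On the additive group <x>_+, a copy of Z, both lambda_a and its inverse
are multiplications by integers. *)
Lemma lambda_add_cycle_sign x a : add_infinite_order x ->
  sb_ideal (add_cycle x) -> sb_lambda a x = x \/ sb_lambda a x = - x.
Proof.
move=> infx idx; have xx : add_cycle x x by exact: add_cycle_id.
have /add_cycleP[e eE] := ideal_lambda a idx xx.
have /add_cycleP[f fE] := ideal_lambda a^-1%g idx xx.
have : (e * f)%R = 1%R.
  by apply: (zmul_inj infx); rewrite zmulM -eE -lambda_zmul -fE lambdaVK.
move=> ef1; have [e1|e1] : e = 1%R \/ e = (- 1)%R.
  by have /eqP := congr1 absz ef1; rewrite abszM muln_eq1 => /andP[/eqP]; lia.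
  by left; rewrite eE e1.
by right; rewrite eE e1.
Qed.

(** Otherwise lambda_x(x) = - x; then x o nx = (1 - n) x, and x is an
involution of (B, o).  The element 3x is also an involution, so <3x>_o = {0, 3x}
is not an additive subgroup; and <3x>_+ is not normal in (B, o), as conjugation
by x sends 3x to - x. *)
Lemma add_cycle_ideal_lambda_self x : add_infinite_order x ->
    sb_ideal (add_cycle x) ->
    sb_ideal (circ_cycle (zmul x 3)) \/ sb_ideal (add_cycle (zmul x 3)) ->
  sb_lambda x x = x.
Proof.
move=> infx idx id3x.
have sgn := lambda_add_cycle_sign _ infx idx.
have inj := zmul_inj infx.
have [//|lamx] := sgn x; exfalso.
have x1 : zmul x 1 = x by [].
have xN1 : zmul x (- 1)%R = - x by [].
have xx0 : x ∘ x = 1%g by rewrite circE lamx sb_addbN one_eq0.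
have xV : x^-1%g = x by apply: mulg1_eq.
have lamNx : sb_lambda (- x) x = - x.
  have [fixx|//] := sgn (- x).
  have : - x ∘ x = x ∘ x by rewrite xx0 circE fixx sb_addNb one_eq0.
  (* x would be its own opposite *)
  by move=> /mulIg; rewrite -xN1 -[RHS]x1 => /inj.
have xM n : x ∘ zmul x n = zmul x (1 - n)%R.
  rewrite circE lambda_zmul lamx -xN1 -zmulM -[X in X + _]x1 -zmulD.
  by congr zmul; lia.
have lam2 : sb_lambda (zmul x 2) x = x.
  rewrite -[zmul x 2](xM (- 1)%R) lambdaM lamNx lambdaN lamx oppK //.
have x3E : zmul x 2 ∘ x = zmul x 3.
  by rewrite circE lam2 -[X in _ + X]x1 -zmulD.
have lam3 : sb_lambda (zmul x 3) x = - x.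
  by rewrite -x3E lambdaM lamx lambdaN lam2.
case: id3x => [[[[_ + _] _] _ _]|[_ _ [_]]].
  (* 3x + 3x = 6x is not in {0, 3x} *)
  have x33 : zmul x 3 ∘ zmul x 3 = 1%g.
    by rewrite circE lambda_zmul lam3 -xN1 -zmulM -zmulD one_eq0.
  have sub2 y : circ_cycle (zmul x 3) y -> y = 1%g \/ y = zmul x 3.
    apply: (@smallest_sub _ _ _ [set y | y = 1%g \/ y = zmul x 3]).
      split; first by left.
        by move=> _ _ [->|->] [->|->]; rewrite ?mul1g ?mulg1 ?x33;
          [left|right|right|left].
      by move=> _ [->|->]; [left; exact: invg1 | right; apply: mulg1_eq].
    by move=> _ ->; right.
  have c3 : circ_cycle (zmul x 3) (zmul x 3) by exact: circ_cycle_id.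
  move=> /(_ _ _ c3 c3); rewrite -zmulD => /sub2.
  rewrite one_eq0 -[0]/(zmul x 0).
  by case=> /inj.
have a3 : add_cycle (zmul x 3) (zmul x 3) by exact: add_cycle_id.
move=> /(_ x _ a3); rewrite xV circE lambdaM lam3 lambdaN lamx oppK xM.
rewrite -[X in _ + X]x1 -zmulD => /add_cycleP[n]; rewrite -zmulM => /inj; lia.
Qed.


Lemma ideal_zmul I x n : sb_ideal I -> I x -> I (zmul x n).
Proof.
by move=> [[[I0 ID IN] _] _ _] Ix; apply: (@expgz_closed (add_group B) I).
Qed.

Lemma ideal_expgz I x n : sb_ideal I -> I x -> I (expgz x n).
Proof. by move=> [_ _ [[I1 IM IV] _]] Ix; apply: (@expgz_closed B I). Qed.

(** The cosets of an ideal are the same for both group laws, because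
- b + a = lambda_b (b^-1 o a). *)
Lemma ideal_cosets I a b : sb_ideal I -> I (- b + a) <-> I (b^-1%g ∘ a).
Proof.
move=> idI; have -> : - b + a = sb_lambda b (b^-1%g ∘ a).
  by rewrite /sb_lambda mulVKg.
split=> [Il|]; last exact: ideal_lambda.
by rewrite -(lambdaKV b (_ ∘ a)); apply: ideal_lambda.
Qed.

(** * Elements of infinite order *)

(** The ideal <x>_o contains the infinitely many multiples of x. *)
Lemma circ_cycle_ideal_aperiodic x :
  add_infinite_order x -> sb_ideal (circ_cycle x) -> aperiodic x.
Proof.
move=> infx idx k k_gt0 xk1.
apply: (@aperiodic_powers_infinite (add_group B) x (fun i => x ^+ i)%g k).
  exact: add_infinite_aperiodic.
move=> n; have : circ_cycle x (zmul x n).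
  by exact: (ideal_zmul n idx (@circ_cycle_id x)).
move=> /circ_cycleP[m]; have [i lt_ik ->] := expgz_periodic m k_gt0 xk1.
by exists i.
Qed.

Lemma add_cycle_ideal_infinite x :
  aperiodic x -> sb_ideal (add_cycle x) -> add_infinite_order x.
Proof.
move=> apx idx k k_gt0; rewrite sb_mulnE => kx0.
apply: (@aperiodic_powers_infinite B x (fun i => zmul x i) k) => // n.
have : add_cycle x (expgz x n) by exact: (ideal_expgz n idx (@add_cycle_id x)).
move=> /add_cycleP[m].
have [i lt_ik eq_i] := @expgz_periodic (add_group B) x k m k_gt0 kx0.
by rewrite /zmul eq_i => eq_n; exists i.
Qed.

Definition cyclic_ideals : Prop :=
  forall b, sb_ideal (circ_cycle b) \/ sb_ideal (add_cycle b).

(** If <x^n>_+ is an ideal instead, it contains the powers of x^n, so it is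
infinite; it is then a trivial brace, and it coincides with <x^n>_o. *)
Lemma circ_cycle_ideal_powers x n : cyclic_ideals -> aperiodic x ->
  n <> 0%R -> sb_ideal (circ_cycle (expgz x n)).
Proof.
move=> hcyc apx n_neq0; set y := expgz x n.
have apy : aperiodic y.
  move=> k k_gt0; rewrite -[(y ^+ k)%g]/(expgz y k) -expgzM.
  by move=> /(expgz_aperiodic_eq1 apx); lia.
have [//|idy] := hcyc y.
have infy := add_cycle_ideal_infinite apy idy.
by rewrite (lambda_self_cycles (add_cycle_ideal_lambda_self infy idy (hcyc _))).
Qed.

(** The exponents d for which lambda_(x^d) fixes x modulo J = <x^p>_o form
a subgroup D of Z.  It contains p.  The elements lambda_(x^k)(x), being outside
J, take only p - 1 values modulo J, so two of them with 0 <= k < l < p agree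
modulo J, and l - k is in D.  As l - k is prime to p, 1 is in D. *)
Lemma lambda_self_mod_prime x (p : nat) : aperiodic x ->
    sb_ideal (circ_cycle x) -> sb_ideal (circ_cycle (expgz x p)) -> prime p ->
  circ_cycle (expgz x p) (- x + sb_lambda x x).
Proof.
move=> apx idx; set J := circ_cycle (expgz x p) => idJ p_pr.
have [[[J0 JD JN] _] _ _] := idJ.
(* after these three facts J is only used through its being an ideal *)
have JP n : J (expgz x n) -> exists m, n = (p%:Z * m)%R.
  by move=> /circ_cycleP[m]; rewrite -expgzM => /(expgz_inj apx) ->; exists m.
have Jp m : J (expgz x (p%:Z * m)%R) by rewrite expgzM; apply: circ_cycle_expgz.
have Jxp : J (expgz x p) by exact: circ_cycle_id.
clearbody J.
pose D n := J (- x + sb_lambda (expgz x n) x).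
have D0 : D 0%R by rewrite /D /= lambda1 sb_addNb.
have DD m n : D m -> D n -> D (m + n)%R.
  move=> Dm Dn; rewrite /D expgzD lambdaM.
  rewrite -(addVKb x (sb_lambda (expgz x n) x)) lambdaD sb_addA.
  by apply: JD => //; apply: ideal_lambda.
have DN n : D n -> D (- n)%R.
  move=> Dn; rewrite /D -[- x + _]oppK; apply: JN; rewrite oppD oppK expgzN.
  rewrite -[X in _ + X](lambdaKV (expgz x n) x) -lambdaN -lambdaD.
  by apply: ideal_lambda.
have DM m n : D n -> D (m * n)%R.
  move=> Dn; elim/int_rect: m => [|m IHm|m IHm]; first by rewrite mul0r.
    by rewrite intS mulrDl mul1r; apply: DD.
  by rewrite intS opprD mulrDl mulN1r; apply: DD => //; apply: DN.
have Dp : D p by apply: ideal_lambdaB.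
(* the residue of the exponent of lambda_(x^k)(x), shifted by 1: it is not 0 *)
have res (k : nat) : exists2 i, (i < p.-1)%N &
    J (- expgz x i.+1 + sb_lambda (expgz x k) x).
  have /circ_cycleP[c cE] : circ_cycle x (sb_lambda (expgz x k) x).
    by exact: (ideal_lambda _ idx (@circ_cycle_id x)).
  have r_neq0 : (c %% p)%Z <> 0%R.
    move=> r0; have [n] : exists n, 1%R = (p%:Z * n)%R.
      apply: JP; rewrite expgz1 -(lambdaKV (expgz x k) x) cE.
      apply: ideal_lambda => //.
      by rewrite (divz_eq c p) r0 addr0 mulrC; apply: Jp.
    move=> /(congr1 absz)/esym/eqP; rewrite abszM muln_eq1 => /andP[/eqP p1 _].
    by have := prime_gt1 p_pr; rewrite -[p]/`|Posz p|%N p1.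
  have p_gt1 := prime_gt1 p_pr.
  exists `|(c %% p)%Z|.-1; first by lia.
  rewrite cE (_ : Posz `|(c %% p)%Z|.-1.+1 = (c %% p)%Z); last by lia.
  apply/ideal_cosets => //.
  rewrite -expgzN -expgzD; suff -> : (- (c %% p)%Z + c = p%:Z * (c %/ p)%Z)%R.
    exact: Jp.
  by rewrite {2}(divz_eq c p) addrC addrK mulrC.
have [k [l [i [/andP[lt_kl le_lp] Jk Jl]]]] := pigeonhole res.
have Dlk : D (l%:Z - k%:Z)%R.
  rewrite /D addrC expgzD expgzN lambdaM.
  rewrite -[X in - X + _](lambdaKV (expgz x k) x).
  rewrite -lambdaN -lambdaD; apply: ideal_lambda => //.
  rewrite -(addVKb (expgz x i.+1) (sb_lambda (expgz x l) x)) sb_addA.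
  apply: JD => //; rewrite -[X in - _ + X]oppK -oppD; exact: JN.
have p_gt1 := prime_gt1 p_pr.
have /eqP co : coprimez (l%:Z - k%:Z)%R p.
  rewrite coprimezE coprime_sym prime_coprime //; apply/negP => /dvdn_leq; lia.
have [u [v uvE]] := Bezoutz (l%:Z - k%:Z)%R p.
have uv1 := etrans uvE co; suff: D 1%R by [].
by rewrite -uv1; apply: DD; apply: DM.
Qed.

(** Writing lambda_x(x) = x^m, the congruences modulo primes say that every
prime divides m - 1; one prime greater than |m - 1| suffices. *)
Lemma circ_cycle_ideal_lambda_self x : cyclic_ideals -> aperiodic x ->
  sb_ideal (circ_cycle x) -> sb_lambda x x = x.
Proof.
move=> hcyc apx idx.
have /circ_cycleP[m mE] : circ_cycle x (sb_lambda x x).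
  by exact: (ideal_lambda _ idx (@circ_cycle_id x)).
have [p lt_mp p_pr] := prime_above `|(m - 1)%R|.
have p_gt1 := prime_gt1 p_pr.
have idp : sb_ideal (circ_cycle (expgz x p)).
  by apply: circ_cycle_ideal_powers => //; lia.
have := lambda_self_mod_prime apx idx idp p_pr; rewrite mE.
move=> /(ideal_cosets _ _ idp); rewrite -{2}[x]expgz1 -expgzN -expgzD.
move=> /circ_cycleP[n]; rewrite -expgzM => /(expgz_inj apx) mn.
have -> : m = 1%R.
  have [n0|n_neq0] := eqVneq n 0%R; first by move: mn; rewrite n0 mulr0; lia.
  have := congr1 absz mn; rewrite abszM /=; have : (0 < `|n|)%N by lia.
  by move=> /(leq_pmulr p); lia.
by rewrite expgz1.
Qed.

Lemma infinite_lambda_self x : cyclic_ideals -> add_infinite_order x ->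
  sb_lambda x x = x.
Proof.
move=> hcyc infx; have [idx|idx] := hcyc x; last first.
  exact: add_cycle_ideal_lambda_self.
exact/circ_cycle_ideal_lambda_self/idx/circ_cycle_ideal_aperiodic.
Qed.

Lemma infinite_add_cycle_ideal x : cyclic_ideals -> add_infinite_order x ->
  sb_ideal (add_cycle x).
Proof.
move=> hcyc infx; have [|//] := hcyc x.
by rewrite (lambda_self_cycles (infinite_lambda_self hcyc infx)).
Qed.

Lemma not_add_infinite a : ~ add_infinite_order a ->
  exists2 k : nat, (0 < k)%N & zmul a k = 0.
Proof.
move=> fina; apply: contrapT => nok; apply: fina => k k_gt0 ka0.
by apply: nok; exists k; rewrite -?sb_mulnE.
Qed.

Lemma not_aperiodic a : ~ aperiodic a ->
  exists2 k : nat, (0 < k)%N & (a ^+ k)%g = 1%g.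
Proof.
move=> fina; apply: contrapT => nok; apply: fina => k k_gt0 ka0.
by apply: nok; exists k.
Qed.

(** The ideal generated by a according to the hypothesis consists of elements
of finite order for one of the two laws, whereas all nonzero elements of <b>
have infinite order for both.  If it is <a>_o, note that a has finite order in
(B, o) too, for otherwise the multiples and the powers of a would coincide. *)
Lemma torsion_ideal a : cyclic_ideals -> ~ add_infinite_order a ->
  exists I, [/\ sb_ideal I, I a &
    forall b, add_infinite_order b -> forall y, I y -> add_cycle b y -> y = 0].
Proof.
move=> hcyc fina; have [k k_gt0 ka0] := not_add_infinite fina.
have [ida|ida] := hcyc a; last first.
  exists (add_cycle a).
  split=> // [|b infb _ /add_cycleP[m ->] /add_cycleP[n nE]].
    exact: add_cycle_id.
  have : zmul b (n * k)%R = zmul b 0.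
    by rewrite zmulM -nE -zmulM mulrC zmulM ka0 /zmul expgz1n.
  by move=> /(zmul_inj infb) nk0; rewrite nE (_ : n = 0%R) //; nia.
have /not_aperiodic[l l_gt0 al1] : ~ aperiodic a.
  move=> apa; apply: (apa k k_gt0); rewrite -[(a ^+ k)%g]/(expgz a k).
  rewrite lambda_self_expgz ?ka0 ?one_eq0 //.
  exact: circ_cycle_ideal_lambda_self.
exists (circ_cycle a).
split=> // [|b infb _ /circ_cycleP[m ->] /add_cycleP[n nE]].
  exact: circ_cycle_id.
have fixb := infinite_lambda_self hcyc infb.
have : zmul b (n * l)%R = zmul b 0.
  rewrite -!lambda_self_expgz // expgzM (lambda_self_expgz n fixb).
  rewrite -nE -expgzM mulrC.
  by rewrite expgzM /= al1 expgz1n.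
by move=> /(zmul_inj infb) nl0; rewrite nE (_ : n = 0%R) //; nia.
Qed.

(** * Triviality of the brace *)

Lemma infinite_lambda_fixed a b : cyclic_ideals -> add_infinite_order b ->
  sb_lambda a b = b.
Proof.
move=> hcyc infb; have idb := infinite_add_cycle_ideal hcyc infb.
have bb : add_cycle b b by exact: add_cycle_id.
have [infa|fina] := pselect (add_infinite_order a); last first.
  have [I [idI Ia disj]] := torsion_ideal hcyc fina.
  exact: (disjoint_ideals_lambda idI idb (disj b infb)).
have ida := infinite_add_cycle_ideal hcyc infa.
have [disj|] := pselect (forall y, add_cycle a y -> add_cycle b y -> y = 0).
  by apply: (disjoint_ideals_lambda ida idb disj) => //; exact: add_cycle_id.
move=> meet; apply: contrapT => moved; apply: meet.
move=> _ /add_cycleP[m ->] /add_cycleP[n nE].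
have /add_cycleP[e eE] := ideal_lambda a idb bb.
have : zmul b (e * n)%R = zmul b n.
  by rewrite zmulM -eE -lambda_zmul -nE lambda_zmul infinite_lambda_self.
move=> /(zmul_inj infb) en; rewrite nE (_ : n = 0%R) //.
apply: contrapT => n_neq0; apply: moved; rewrite eE (_ : e = 1%R) //.
by apply: (mulIf (x := n)); [apply/eqP | rewrite mul1r].
Qed.

(** If kb = 0, then lk (b + x) = lk x for every l. *)
Lemma add_infinite_torsion_shift b x : b + x = x + b ->
  ~ add_infinite_order b -> add_infinite_order x -> add_infinite_order (b + x).
Proof.
move=> bxC /not_add_infinite[k k_gt0 kb0] infx l l_gt0.
rewrite sb_mulnE => lbx0.
have : zmul (b + x) (l * k)%N = zmul x (l * k)%N.
  rewrite /zmul /= (@expgMn (add_group B) b x) //.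
  by rewrite mulnC expgnA -[(_ ^+ k)%g]/(zmul b k) kb0 expg1n mul1g.
rewrite PoszM zmulM lbx0 /zmul expgz1n -[1%g]/(zmul x 0).
by move=> /(zmul_inj infx); nia.
Qed.

End SkewBrace.

Theorem theorem4p16 (B : skewBraceType)
    (hcyc : forall b : B, sb_ideal (circ_cycle b) \/ sb_ideal (add_cycle b))
    (hinf : exists x : B, add_infinite_order x) :
  trivial_brace B.
Proof.
have [x infx] := hinf; move=> a b; rewrite circE; congr sb_add.
have [infb|finb] := pselect (add_infinite_order b).
  by rewrite infinite_lambda_fixed.
have [I [idI Ib disj]] := torsion_ideal hcyc finb.
have bxC : sb_add b x = sb_add x b.
  apply: (disjoint_ideals_addC idI _ (disj x infx)) => //.
    exact: infinite_add_cycle_ideal.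
  exact: add_cycle_id.
have infbx := add_infinite_torsion_shift bxC finb infx.
(* b = (b + x) - x is a combination of fixed points of lambda_a *)
apply: (@addIb _ x); rewrite -{2}(infinite_lambda_fixed a hcyc infx) -lambdaD.
by rewrite infinite_lambda_fixed.
Qed.
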